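(* Let $M$ and $N$ be complete Riemannian manifolds, let $\nabla$ be the Levi-Civita connection of $M$, let $\varphi:\mathbb{R}\times\mathbb{R}\to\mathbb{R}$, let $A\subseteq M$ be a totally convex set, and let $f:A\to\mathbb{R}$ be a geodesic $\varphi$-convex function. If $F:(M,\nabla)\to(N,\nabla_1)$ is a diffeomorphism, where $\nabla_1=F_*\nabla$ is the push-forward connection on $N$, then $f\circ F^{-1}:F(A)\to\mathbb{R}$ is a geodesic $\varphi$-convex function (with respect to the geodesics of $\nabla_1$).
   Context: For a manifold with an affine connection, $\alpha_{xy}:[0,1]\to M$ denotes a geodesic arc (of that connection) with $\alpha_{xy}(0)=x$ and $\alpha_{xy}(1)=y$. A non-empty subset $A$ is totally convex if it contains every geodesic $\alpha_{xy}$ whose end points $x,y$ belong to $A$. A function $f:A\to\mathbb{R}$ on a totally convex set $A$ is geodesic $\varphi$-convex if $f(\alpha_{xy}(t))\le f(x)+t\,\varphi(f(y),f(x))$ for all $x,y\in A$, every geodesic arc $\alpha_{xy}$ from $x$ to $y$, and all $t\in[0,1]$. On $M$ the geodesics are those of $\nabla$; on $N$ they are those of the affine connection $\nabla_1=F_*\nabla$, defined by $(\nabla_1)_{F_*X}(F_*Y)=F_*(\nabla_XY)$ for vector fields $X,Y$ on $M$. *)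

(* Defs.v *)
From HB Require Import structures.
From mathcomp Require Import all_boot all_order all_algebra.
From mathcomp Require Import all_classical all_reals all_analysis.

Set Implicit Arguments.
Unset Strict Implicit.
Unset Printing Implicit Defensive.

Import Order.TTheory GRing.Theory Num.Theory.
Import numFieldNormedType.Exports.

Local Open Scope classical_set_scope.
Local Open Scope ring_scope.

(** * Smooth maps between normed spaces *)

(* Iterated Fréchet differentiability: the condition on ['D_v f] for all [v] is
   the one on the differential [x |-> 'd f x], tested on each vector. *)
Fixpoint differentiable_n_on (R : realType) (V W : normedModType R) (k : nat)
    (U : set V) (f : V -> W) : Prop :=
  if k is k'.+1 then
    (forall x, U x -> differentiable f x) /\
    (forall v, differentiable_n_on k' U ('D_v f))
  else True.

Definition smooth_on (R : realType) (V W : normedModType R)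
    (U : set V) (f : V -> W) : Prop :=
  forall k, differentiable_n_on k U f.

(** * Smooth manifolds *)

(* Only the values of [cmap] on [cdom] and of [cinv] on [cimg] are relevant. *)
Record chart (R : realType) (n : nat) (M : topologicalType) := Chart {
  cdom : set M;
  cmap : M -> 'rV[R]_n;
  cinv : 'rV[R]_n -> M;
  cdom_open : open cdom;
  cimg_open : open (cmap @` cdom);
  cmapK : {in cdom, cancel cmap cinv};
  cmap_cont : {in cdom, continuous cmap};
  cinv_cont : {in cmap @` cdom, continuous cinv} }.

Definition smooth_transition (R : realType) (n : nat) (M : topologicalType)
    (c d : chart R n M) : Prop :=
  smooth_on (cmap c @` (cdom c `&` cdom d)) (cmap d \o cinv c).

Record manifold (R : realType) (n : nat) := Manifold {
  points :> topologicalType;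
  points_hausdorff : hausdorff_space points;
  points_second_countable : @second_countable points;
  atlas : set (chart R n points);
  atlas_cover : forall p, exists2 c, atlas c & cdom c p;
  atlas_compatible : forall c d, atlas c -> atlas d -> smooth_transition c d;
  atlas_maximal : forall c,
    (forall d, atlas d -> smooth_transition c d /\ smooth_transition d c) ->
    atlas c }.

Definition smooth_map (R : realType) (m n : nat)
    (M : manifold R m) (N : manifold R n) (F : M -> N) : Prop :=
  continuous F /\
  forall c d, atlas c -> atlas d ->
    smooth_on (cmap c @` (cdom c `&` F @^-1` cdom d)) (cmap d \o F \o cinv c).

Definition diffeomorphism (R : realType) (m n : nat)
    (M : manifold R m) (N : manifold R n) (F : M -> N) (Finv : N -> M) : Prop :=
  [/\ cancel F Finv, cancel Finv F, smooth_map F & smooth_map Finv].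

Definition smooth_fun (R : realType) (n : nat) (M : manifold R n)
    (h : M -> R) : Prop :=
  forall c, atlas c -> smooth_on (cmap c @` cdom c) (h \o cinv c).

Definition smooth_curve_on (R : realType) (n : nat) (M : manifold R n)
    (J : set R) (gamma : R -> M) : Prop :=
  {in J, continuous gamma} /\
  forall c, atlas c ->
    smooth_on (J `&` gamma @^-1` cdom c) (cmap c \o gamma).

(** * Tangent vectors and vector fields *)

(* A tangent vector is a derivation of the algebra of smooth functions. It is
   represented by a functional on all functions which is 0 on the non-smooth
   ones, so that equal derivations are represented by equal functionals. *)
Definition tangent (R : realType) (n : nat) (M : manifold R n) (p : M)
    (v : (M -> R) -> R) : Prop :=
  [/\ forall h, ~ smooth_fun h -> v h = 0,
      forall a h k, smooth_fun h -> smooth_fun k ->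
        v (fun q => a * h q + k q) = a * v h + v k &
      forall h k, smooth_fun h -> smooth_fun k ->
        v (fun q => h q * k q) = h p * v k + v h * k p].

(* A vector field [X] acts on functions; its value at [p] is [at_point X p]. *)
Definition at_point (R : realType) (n : nat) (M : manifold R n)
    (X : (M -> R) -> (M -> R)) (p : M) : (M -> R) -> R := fun h => X h p.

Definition vector_field (R : realType) (n : nat) (M : manifold R n)
    (X : (M -> R) -> (M -> R)) : Prop :=
  (forall p, tangent p (at_point X p)) /\
  (forall h, smooth_fun h -> smooth_fun (X h)).

Definition pushforward (R : realType) (m n : nat)
    (M : manifold R m) (N : manifold R n) (F : M -> N) (Finv : N -> M)
    (X : (M -> R) -> (M -> R)) : (N -> R) -> (N -> R) :=
  fun h => X (h \o F) \o Finv.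

(** * Affine connections and geodesics *)

Notation connection R M :=
  (((M -> R) -> (M -> R)) -> ((M -> R) -> (M -> R)) -> ((M -> R) -> (M -> R))).

Definition affine_connection (R : realType) (n : nat) (M : manifold R n)
    (nabla : connection R M) : Prop :=
  [/\ forall X Y, vector_field X -> vector_field Y -> vector_field (nabla X Y),
      forall f X Z Y, smooth_fun f ->
        vector_field X -> vector_field Z -> vector_field Y ->
        nabla (fun h p => f p * X h p + Z h p) Y =
        (fun h p => f p * nabla X Y h p + nabla Z Y h p),
      forall a X Y Z, vector_field X -> vector_field Y -> vector_field Z ->
        nabla X (fun h p => a * Y h p + Z h p) =
        (fun h p => a * nabla X Y h p + nabla X Z h p) &
      forall f X Y, smooth_fun f -> vector_field X -> vector_field Y ->
        nabla X (fun h p => f p * Y h p) =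
        (fun h p => f p * nabla X Y h p + X f p * Y h p)].

Definition pushforward_connection (R : realType) (m n : nat)
    (M : manifold R m) (N : manifold R n) (F : M -> N) (Finv : N -> M)
    (nabla : connection R M) : connection R N :=
  fun X Y => pushforward F Finv
    (nabla (pushforward Finv F X) (pushforward Finv F Y)).

Lemma pushforwardK (R : realType) (m n : nat)
    (M : manifold R m) (N : manifold R n) (F : M -> N) (Finv : N -> M)
    (X : (M -> R) -> (M -> R)) : cancel F Finv ->
  pushforward Finv F (pushforward F Finv X) = X.
Proof.
move=> FK; apply/funext => h; apply/funext => p.
rewrite /pushforward /= FK; congr (X _ p).
by apply/funext => q /=; rewrite FK.
Qed.

(* The identity by which the push-forward connection is usually defined. *)
Lemma pushforward_connectionE (R : realType) (m n : nat)
    (M : manifold R m) (N : manifold R n) (F : M -> N) (Finv : N -> M)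
    (nabla : connection R M) (X Y : (M -> R) -> (M -> R)) : cancel F Finv ->
  pushforward_connection F Finv nabla
    (pushforward F Finv X) (pushforward F Finv Y) =
  pushforward F Finv (nabla X Y).
Proof. by move=> FK; rewrite /pushforward_connection !pushforwardK. Qed.

Definition velocity (R : realType) (n : nat) (M : manifold R n)
    (gamma : R -> M) (t : R) : (M -> R) -> R :=
  fun h => if `[< smooth_fun h >] then derive1 (h \o gamma) t else 0.

Definition vector_field_along (R : realType) (n : nat) (M : manifold R n)
    (J : set R) (gamma : R -> M) (V : R -> (M -> R) -> R) : Prop :=
  (forall t, J t -> tangent (gamma t) (V t)) /\
  (forall h, smooth_fun h -> smooth_on J (fun t => V t h)).

(* For [gamma] smooth on the open set [J], there is exactly one such operator,
   up to values outside [J]: the covariant derivative [V |-> DV/dt]. *)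
Definition covariant_derivative_along (R : realType) (n : nat)
    (M : manifold R n) (nabla : connection R M) (J : set R) (gamma : R -> M)
    (D : (R -> (M -> R) -> R) -> (R -> (M -> R) -> R)) : Prop :=
  [/\ forall V, vector_field_along J gamma V ->
        vector_field_along J gamma (D V),
      forall a V W,
        vector_field_along J gamma V -> vector_field_along J gamma W ->
        forall t, J t ->
        D (fun s h => a * V s h + W s h) t =
        (fun h => a * D V t h + D W t h),
      forall (a : R -> R) V,
        smooth_on J a -> vector_field_along J gamma V ->
        forall t, J t ->
        D (fun s h => a s * V s h) t =
        (fun h => derive1 a t * V t h + a t * D V t h) &
      forall X Y t, vector_field X -> vector_field Y -> J t ->
        at_point X (gamma t) = velocity gamma t ->
        D (fun s => at_point Y (gamma s)) t = at_point (nabla X Y) (gamma t)].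

(* The geodesic equation: the covariant derivative of the velocity is 0. *)
Definition geodesic_on (R : realType) (n : nat) (M : manifold R n)
    (nabla : connection R M) (J : set R) (gamma : R -> M) : Prop :=
  smooth_curve_on J gamma /\
  exists2 D, covariant_derivative_along nabla J gamma D &
    forall t, J t -> D (velocity gamma) t = (fun=> 0).

(* A geodesic arc is parametrised by [0, 1]; as usual for curves on a closed
   interval, it is the restriction of a geodesic on a larger open interval.
   The values of [alpha] far from [0, 1] are irrelevant. *)
Definition geodesic_arc (R : realType) (n : nat) (M : manifold R n)
    (nabla : connection R M) (x y : M) (alpha : R -> M) : Prop :=
  [/\ exists2 e : R, 0 < e & geodesic_on nabla `]- e, 1 + e[ alpha,
      alpha 0 = x & alpha 1 = y].

Definition geodesically_complete (R : realType) (n : nat) (M : manifold R n)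
    (nabla : connection R M) : Prop :=
  forall (p : M) v, tangent p v ->
    exists gamma : R -> M,
      [/\ geodesic_on nabla setT gamma, gamma 0 = p & velocity gamma 0 = v].

(** * Riemannian metrics *)

Record riemannian_metric (R : realType) (n : nat) (M : manifold R n) :=
    RiemannianMetric {
  metric :> forall p : M, ((M -> R) -> R) -> ((M -> R) -> R) -> R;
  metric_linear : forall p a u v w, tangent p u -> tangent p v -> tangent p w ->
    metric p (fun h => a * u h + v h) w = a * metric p u w + metric p v w;
  metric_sym : forall p u v, tangent p u -> tangent p v ->
    metric p u v = metric p v u;
  metric_pos : forall p u, tangent p u -> u <> (fun=> 0) -> 0 < metric p u u;
  metric_smooth : forall X Y, vector_field X -> vector_field Y ->
    smooth_fun (fun p => metric p (at_point X p) (at_point Y p)) }.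

(* Torsion-free and compatible with the metric. *)
Definition levi_civita (R : realType) (n : nat) (M : manifold R n)
    (g : riemannian_metric M) (nabla : connection R M) : Prop :=
  [/\ affine_connection nabla,
      forall X Y, vector_field X -> vector_field Y ->
        forall h, smooth_fun h -> forall p,
        nabla X Y h p - nabla Y X h p = X (Y h) p - Y (X h) p &
      forall X Y Z, vector_field X -> vector_field Y -> vector_field Z ->
        forall p,
        X (fun q => g q (at_point Y q) (at_point Z q)) p =
        g p (at_point (nabla X Y) p) (at_point Z p) +
        g p (at_point Y p) (at_point (nabla X Z) p)].

Definition complete_riemannian (R : realType) (n : nat) (M : manifold R n)
    (g : riemannian_metric M) : Prop :=
  exists2 nabla, levi_civita g nabla & geodesically_complete nabla.

(** * Geodesic convexity *)

Definition totally_convex (R : realType) (n : nat) (M : manifold R n)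
    (nabla : connection R M) (A : set M) : Prop :=
  A !=set0 /\
  forall x y alpha, A x -> A y -> geodesic_arc nabla x y alpha ->
    forall t : R, 0 <= t <= 1 -> A (alpha t).

(* A function on [A] is given by a total function, whose values outside [A]
   are not used. *)
Definition geodesic_phi_convex (R : realType) (n : nat) (M : manifold R n)
    (nabla : connection R M) (phi : R -> R -> R) (A : set M) (f : M -> R) :
    Prop :=
  totally_convex nabla A /\
  forall x y alpha, A x -> A y -> geodesic_arc nabla x y alpha ->
    forall t : R, 0 <= t <= 1 -> f (alpha t) <= f x + t * phi (f y) (f x).

(* Main.v *)
Require Import Defs.
From HB Require Import structures.
From mathcomp Require Import all_boot all_order all_algebra.
From mathcomp Require Import all_classical all_reals all_analysis.

Set Implicit Arguments.
Unset Strict Implicit.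
Unset Printing Implicit Defensive.

Import Order.TTheory GRing.Theory Num.Theory.
Import numFieldNormedType.Exports.

Local Open Scope classical_set_scope.
Local Open Scope ring_scope.

(** A diffeomorphism [F] carries every ingredient of the geodesic equation of
    [nabla] to the corresponding ingredient for the push-forward connection,
    so [F \o gamma] is a geodesic of the latter whenever [gamma] is one of
    [nabla].  Since pushing the push-forward connection back along [Finv] gives
    [nabla] again ([pushforward_connectionK]), [Finv] carries geodesic arcs
    from [F x] to [F y] to geodesic arcs from [x] to [y].  Total convexity of
    [F @` A] and the inequality for [f \o Finv] along an arc [alpha] are then
    those of [A] and [f] along [Finv \o alpha].

    The substance is therefore [pushforward_geodesic_on].  It has two parts.

    Smoothness: smooth functions and smooth curves must remain smooth when
    composed with [F].  As smoothness is iterated Frechet differentiability,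
    tested one direction at a time, this is the chain rule of order k on open
    subsets of coordinate spaces, obtained by induction on k from
      D_v (g o f) = sum_i (D_v f)_i * (D_{e_i} g o f)
    and from the stability of k-fold differentiability under sums and products.
    Smoothness being local, the result then passes to manifolds chart by chart
    ([smooth_fun_comp], [smooth_curve_comp]).

    Algebra: composition with [F] and [Finv] transports derivations, vector
    fields and vector fields along a curve, and the velocity of [F \o gamma]
    is the push-forward of that of [gamma].  If [D] is the covariant derivative
    along [gamma], its conjugate [F_* o D o (Finv)_*] satisfies the
    characterization of the covariant derivative along [F \o gamma] for the
    push-forward connection ([pushforward_covariant_derivative]), and it
    annihilates the velocity of [F \o gamma] because [D] annihilates that of
    [gamma]. *)

(** * Differentials of composites *)

Lemma near_eq_differentiable (R : realType) (V W : normedModType R)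
    (f g : V -> W) (x : V) :
  (\forall y \near x, f y = g y) -> differentiable f x -> differentiable g x.
Proof.
move=> fg /diff_locallyP[df_cont df].
have dg : g \o shift x = cst (g x) + 'd f x +o_ 0 id.
  apply/eqaddoP => e e0.
  have fgx := nbhs_singleton fg.
  have fg0 : \forall h \near 0, f (h + x) = g (h + x).
    by move: fg; rewrite (near_shift 0) subr0.
  move/eqaddoP: df => /(_ e e0); apply: filterS2 fg0 => h.
  by rewrite !fctE /= => fgh; rewrite fgh fgx.
apply/diff_locallyP.
by rewrite (diff_unique df_cont dg).
Qed.

Lemma derive_linear_comp (R : realType) (V W W' : normedModType R)
    (L : {linear W -> W'}) (f : V -> W) (x v : V) :
  continuous L -> differentiable f x -> 'D_v (L \o f) x = L ('D_v f x).
Proof.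
move=> Lc df; have dL := linear_differentiable (f x) Lc.
rewrite !deriveE//; last exact: differentiable_comp.
by rewrite diff_comp//= diff_lin.
Qed.

(** The chain rule written with directional derivatives only: this is the form
    on which an induction on the order of differentiability can operate, since
    [differentiable_n_on] speaks of the maps ['D_v f] and not of the
    differential. *)
Lemma derive_comp_coord (R : realType) (V : normedModType R) (n : nat)
    (f : V -> 'rV[R]_n) (g : 'rV[R]_n -> R) (x v : V) :
  differentiable f x -> differentiable g (f x) ->
  'D_v (g \o f) x =
  \sum_(i < n) ('D_v f x) 0 i * 'D_(delta_mx 0 i) g (f x).
Proof.
move=> df dg; rewrite deriveE; last exact: differentiable_comp.
rewrite diff_comp//= -(deriveE _ df) [in LHS](row_sum_delta ('D_v f x)).
rewrite linear_sum.
by apply: eq_bigr => i _; rewrite linearZ/= -deriveE.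
Qed.

(** * Repeatedly differentiable maps on a subset *)

Lemma sub_differentiable_n_on (R : realType) (V W : normedModType R) (k : nat)
    (U U' : set V) (f : V -> W) :
  U `<=` U' -> differentiable_n_on k U' f -> differentiable_n_on k U f.
Proof.
move=> UU'; elim: k f => //= k IHk f [df Df]; split => [x /UU' /df //|v].
exact: IHk.
Qed.

(** The sets [B] may be arbitrary: [differentiable f x] and ['D_v f x] already
    refer to a full neighbourhood of [x] in the ambient space, so being k
    times differentiable on a set is a condition imposed point by point. *)
Lemma differentiable_n_on_local (R : realType) (V W : normedModType R) (k : nat)
    (U : set V) (f : V -> W) :
  (forall x, U x -> exists2 B : set V, B x & differentiable_n_on k B f) ->
  differentiable_n_on k U f.
Proof.
elim: k f => //= k IHk f loc; split=> [x /loc[B Bx [df _]]|v]; first exact: df.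
by apply: IHk => x /loc[B Bx [_ Df]]; exists B.
Qed.

(** Openness is essential here: derivatives at a point of [U] depend on the
    values nearby, where [f] and [g] must still agree. *)
Lemma eq_differentiable_n_on (R : realType) (V W : normedModType R) (k : nat)
    (U : set V) (f g : V -> W) :
  open U -> {in U, f =1 g} ->
  differentiable_n_on k U f -> differentiable_n_on k U g.
Proof.
move=> Uo; elim: k f g => //= k IHk f g fg [df Df].
have fgn x : U x -> \forall y \near x, f y = g y.
  by move=> Ux; apply: filterS (open_nbhs_nbhs (conj Uo Ux)) => y /mem_set/fg.
split=> [x Ux|v].
  exact: near_eq_differentiable (fgn x Ux) (df x Ux).
apply: IHk (Df v) => x /set_mem Ux; exact: near_eq_derive (fgn x Ux).
Qed.

Lemma differentiable_n_onW (R : realType) (V W : normedModType R) (k : nat)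
    (U : set V) (f : V -> W) :
  differentiable_n_on k.+1 U f -> differentiable_n_on k U f.
Proof.
elim: k f => // k IHk f [df Df]; split=> // v; exact: IHk.
Qed.

Lemma differentiable_n_on_linear_comp (R : realType) (V W W' : normedModType R)
    (k : nat) (U : set V) (L : {linear W -> W'}) (f : V -> W) :
  open U -> continuous L ->
  differentiable_n_on k U f -> differentiable_n_on k U (L \o f).
Proof.
move=> Uo Lc; elim: k f => //= k IHk f [df Df]; split=> [x Ux|v].
  by apply: differentiable_comp; [exact: df|exact: linear_differentiable].
apply: eq_differentiable_n_on (IHk _ (Df v)) => // x /set_mem Ux /=.
by rewrite derive_linear_comp//; exact: df.
Qed.

Lemma differentiable_n_on_sum (R : realType) (V W : normedModType R)
    (k n : nat) (U : set V) (f : 'I_n -> V -> W) :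
  open U -> (forall i, differentiable_n_on k U (f i)) ->
  differentiable_n_on k U (\sum_(i < n) f i).
Proof.
move=> Uo; elim: k f => //= k IHk f df; split=> [x Ux|v].
  by apply: differentiable_sum => i; exact: (df i).1.
have Df i : differentiable_n_on k U ('D_v (f i)) by exact: (df i).2.
apply: eq_differentiable_n_on (IHk _ Df) => // x /set_mem Ux.
rewrite derive_sum ?fct_sumE// => i.
by apply: diff_derivable; exact: (df i).1.
Qed.

Lemma differentiable_n_onD (R : realType) (V W : normedModType R)
    (k : nat) (U : set V) (f g : V -> W) :
  open U -> differentiable_n_on k U f -> differentiable_n_on k U g ->
  differentiable_n_on k U (f + g).
Proof.
move=> Uo; elim: k f g => //= k IHk f g [df Df] [dg Dg]; split=> [x Ux|v].
  by apply: differentiableD; [exact: df|exact: dg].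
apply: eq_differentiable_n_on (IHk _ _ (Df v) (Dg v)) => // x /set_mem Ux.
by rewrite deriveD//; apply: diff_derivable; [exact: df|exact: dg].
Qed.

Lemma differentiable_n_onM (R : realType) (V : normedModType R)
    (k : nat) (U : set V) (f g : V -> R) :
  open U -> differentiable_n_on k U f -> differentiable_n_on k U g ->
  differentiable_n_on k U (f * g).
Proof.
move=> Uo; elim: k f g => //= k IHk f g df dg.
have [[df1 Df] [dg1 Dg]] := (df, dg).
split=> [x Ux|v].
  by apply: differentiableM; [exact: df1|exact: dg1].
have := differentiable_n_onD Uo (IHk _ _ (differentiable_n_onW df) (Dg v))
  (IHk _ _ (differentiable_n_onW dg) (Df v)).
apply: eq_differentiable_n_on => // x /set_mem Ux.
by rewrite deriveM//; apply: diff_derivable; [exact: df1|exact: dg1].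
Qed.

Lemma differentiable_n_on_coord (R : realType) (V : normedModType R)
    (n k : nat) (U : set V) (f : V -> 'rV[R]_n) (i : 'I_n) : open U ->
  differentiable_n_on k U f -> differentiable_n_on k U (fun x => f x 0 i).
Proof.
move=> Uo.
have coord_linear : linear (fun u : 'rV[R]_n => u 0 i).
  by move=> a u w; rewrite !mxE.
pose coordM := GRing.isLinear.Build R 'rV[R]_n R _ _ coord_linear.
pose L : {linear 'rV[R]_n -> R} := HB.pack (fun u : 'rV[R]_n => u 0 i) coordM.
apply: (differentiable_n_on_linear_comp (L := L)) => //.
exact: coord_continuous.
Qed.

(** By induction on [k]: each term of the chain rule [derive_comp_coord] is a
    product of two maps that are differentiable one time less, the second one
    by the induction hypothesis applied to the partial derivative of [g]. *)
Lemma differentiable_n_on_comp_real (R : realType) (V : normedModType R)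
    (n k : nat) (U : set V) (U' : set 'rV[R]_n)
    (f : V -> 'rV[R]_n) (g : 'rV[R]_n -> R) :
  open U -> (forall x, U x -> U' (f x)) ->
  differentiable_n_on k U f -> differentiable_n_on k U' g ->
  differentiable_n_on k U (g \o f).
Proof.
move=> Uo UU'; elim: k f g UU' => //= k IHk f g UU' df dg.
have [[df1 Df] [dg1 Dg]] := (df, dg).
split=> [x Ux|v].
  by apply: differentiable_comp; [exact: df1|exact/dg1/UU'].
have H (i : 'I_n) : differentiable_n_on k U
    (((fun u : 'rV[R]_n => u 0 i) \o 'D_v f) * ('D_(delta_mx 0 i) g \o f)).
  apply: differentiable_n_onM => //.
    exact: differentiable_n_on_coord.
  exact: IHk (differentiable_n_onW df) (Dg _).
apply: eq_differentiable_n_on (differentiable_n_on_sum Uo H) => // x.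
move=> /set_mem Ux; rewrite fct_sumE derive_comp_coord//; first exact: df1.
exact/dg1/UU'.
Qed.

(** A vector is the sum of its coordinates times the basis vectors, so
    vector-valued maps reduce to their scalar components. *)
Lemma differentiable_n_on_rV (R : realType) (V : normedModType R) (n k : nat)
    (U : set V) (f : V -> 'rV[R]_n) : open U ->
  (forall i, differentiable_n_on k U (fun x => f x 0 i)) ->
  differentiable_n_on k U f.
Proof.
move=> Uo df.
have -> : f = \sum_(i < n) (( *:%R ^~ (delta_mx 0 i)) \o (fun x => f x 0 i)).
  by apply/funext => x; rewrite fct_sumE [LHS]row_sum_delta.
apply: differentiable_n_on_sum => // i.
pose e : 'rV[R]_n := delta_mx 0 i.
have scale_linear : linear ( *:%R ^~ e : R -> _).
  by move=> a u w; rewrite scalerDl scalerA.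
pose scaleM := GRing.isLinear.Build R R 'rV[R]_n _ _ scale_linear.
pose L : {linear R -> 'rV[R]_n} := HB.pack ( *:%R ^~ e) scaleM.
apply: (differentiable_n_on_linear_comp (L := L)) => //.
exact: scalel_continuous.
Qed.

Lemma differentiable_n_on_comp (R : realType) (V : normedModType R)
    (n p k : nat) (U : set V) (U' : set 'rV[R]_n)
    (f : V -> 'rV[R]_n) (g : 'rV[R]_n -> 'rV[R]_p) :
  open U -> open U' -> (forall x, U x -> U' (f x)) ->
  differentiable_n_on k U f -> differentiable_n_on k U' g ->
  differentiable_n_on k U (g \o f).
Proof.
move=> Uo U'o UU' df dg; apply: differentiable_n_on_rV => // i.
apply: (@differentiable_n_on_comp_real _ _ _ _ _ U' f (fun u => g u 0 i)) => //.
exact: differentiable_n_on_coord.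
Qed.

(** * Smooth maps *)

Lemma smooth_on_comp_real (R : realType) (V : normedModType R) (n : nat)
    (U : set V) (U' : set 'rV[R]_n) (f : V -> 'rV[R]_n) (g : 'rV[R]_n -> R) :
  open U -> (forall x, U x -> U' (f x)) ->
  smooth_on U f -> smooth_on U' g -> smooth_on U (g \o f).
Proof.
by move=> Uo UU' sf sg k; exact: differentiable_n_on_comp_real (sf k) (sg k).
Qed.

Lemma smooth_on_comp (R : realType) (V : normedModType R) (n p : nat)
    (U : set V) (U' : set 'rV[R]_n)
    (f : V -> 'rV[R]_n) (g : 'rV[R]_n -> 'rV[R]_p) :
  open U -> open U' -> (forall x, U x -> U' (f x)) ->
  smooth_on U f -> smooth_on U' g -> smooth_on U (g \o f).
Proof.
by move=> Uo U'o UU' sf sg k; exact: differentiable_n_on_comp (sf k) (sg k).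
Qed.

Lemma sub_smooth_on (R : realType) (V W : normedModType R)
    (U U' : set V) (f : V -> W) :
  U `<=` U' -> smooth_on U' f -> smooth_on U f.
Proof. by move=> UU' sf k; exact: sub_differentiable_n_on (sf k). Qed.

Lemma smooth_on_local (R : realType) (V W : normedModType R)
    (U : set V) (f : V -> W) :
  (forall x, U x -> exists2 B : set V, B x & smooth_on B f) -> smooth_on U f.
Proof.
move=> loc k; apply: differentiable_n_on_local => x /loc[B Bx sf].
by exists B.
Qed.

Lemma eq_smooth_on (R : realType) (V W : normedModType R)
    (U : set V) (f g : V -> W) :
  open U -> {in U, f =1 g} -> smooth_on U f -> smooth_on U g.
Proof. by move=> Uo fg sf k; exact: eq_differentiable_n_on (sf k). Qed.

(** * Smoothness in charts *)

Lemma openI_preimage (S T : topologicalType) (U : set S) (W : set T)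
    (f : S -> T) :
  open U -> open W -> {in U, continuous f} -> open (U `&` f @^-1` W).
Proof.
move=> Uo Wo fc; rewrite openE => x [Ux Wfx]; apply: filterI.
  exact: open_nbhs_nbhs.
exact/(fc x (mem_set Ux))/open_nbhs_nbhs.
Qed.

Lemma chart_image_open (R : realType) (n : nat) (M : topologicalType)
    (c : chart R n M) (W : set M) :
  open W -> open (cmap c @` (cdom c `&` W)).
Proof.
move=> Wo.
have -> : cmap c @` (cdom c `&` W) = cmap c @` cdom c `&` cinv c @^-1` W.
  apply/seteqP; split=> [_ [p [cp Wp] <-]|_ [[p cp <-]]] /=.
    by rewrite cmapK ?inE//; split=> //; exists p.
  by rewrite cmapK ?inE// => Wp; exists p.
apply: openI_preimage => //; [exact: cimg_open|exact: cinv_cont].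
Qed.

(** Near a point, [h \o F] read in a chart [c] is [h] read in a chart [d] around
    the image point, composed with [F] read in [c] and [d]. *)
Lemma smooth_fun_comp (R : realType) (m n : nat)
    (M : manifold R m) (N : manifold R n) (F : M -> N) (h : N -> R) :
  smooth_map F -> smooth_fun h -> smooth_fun (h \o F).
Proof.
move=> [Fc sF] sh c ac; apply: smooth_on_local => _ [p cp <-].
have [d ad dFp] := atlas_cover (F p).
exists (cmap c @` (cdom c `&` F @^-1` cdom d)); first by exists p.
have Bo : open (cmap c @` (cdom c `&` F @^-1` cdom d)).
  by apply/chart_image_open/open_comp => [x _|]; [exact: Fc|exact: cdom_open].
apply: (eq_smooth_on (f := (h \o cinv d) \o (cmap d \o F \o cinv c))) => //.
  move=> _ /set_mem[q [cq dFq] <-] /=.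
  by rewrite (cmapK (c := c)) ?inE// cmapK ?inE.
apply: smooth_on_comp_real (sF _ _ ac ad) (sh _ ad) => // _ [q [cq dFq] <-] /=.
by rewrite (cmapK (c := c)) ?inE//; exists (F q).
Qed.

(** Near a time [t], the curve [F \o gamma] read in [d] is [F] read in [c] and
    [d], composed with [gamma] read in a chart [c] around [gamma t]. *)
Lemma smooth_curve_comp (R : realType) (m n : nat)
    (M : manifold R m) (N : manifold R n) (F : M -> N)
    (J : set R) (gamma : R -> M) :
  open J -> smooth_map F -> smooth_curve_on J gamma ->
  smooth_curve_on J (F \o gamma).
Proof.
move=> Jo [Fc sF] [gc sg]; split=> [t Jt|d ad].
  by apply: continuous_comp; [exact: gc|exact: Fc].
apply: smooth_on_local => t [Jt dFt].
have [c ac ct] := atlas_cover (gamma t).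
pose W := cdom c `&` F @^-1` cdom d.
have Wo : open W.
  apply: openI; first exact: cdom_open.
  by apply: open_comp => [x _|]; [exact: Fc|exact: cdom_open].
have Bo : open (J `&` gamma @^-1` W) by exact: openI_preimage.
exists (J `&` gamma @^-1` W) => //.
apply: (eq_smooth_on (f := (cmap d \o F \o cinv c) \o (cmap c \o gamma))) => //.
  by move=> s /set_mem[_ [cs _]] /=; rewrite cmapK ?inE.
apply: smooth_on_comp (sF _ _ ac ad) => //.
- apply: chart_image_open.
  by apply: open_comp => [x _|]; [exact: Fc|exact: cdom_open].
- by move=> s [_ Ws]; exists (gamma s).
- by apply: sub_smooth_on (sg _ ac) => s [Js [cs _]].
Qed.

(** * Transport of tangent vectors and vector fields *)

Lemma diffeomorphism_sym (R : realType) (m n : nat)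
    (M : manifold R m) (N : manifold R n) (F : M -> N) (Finv : N -> M) :
  diffeomorphism F Finv -> diffeomorphism Finv F.
Proof. by case. Qed.

Lemma comp_cancel (A B C : Type) (F : A -> B) (G : B -> A) (h : A -> C) :
  cancel F G -> (h \o G) \o F = h.
Proof. by move=> FK; apply/funext => x /=; rewrite FK. Qed.

(** Both directions matter: tangent vectors and velocities are extended by 0 to
    non-smooth functions, so transport must preserve non-smoothness too. *)
Lemma diffeo_smooth_fun (R : realType) (m n : nat)
    (M : manifold R m) (N : manifold R n) (F : M -> N) (Finv : N -> M)
    (h : N -> R) :
  diffeomorphism F Finv -> smooth_fun (h \o F) <-> smooth_fun h.
Proof.
move=> [FK FinvK sF sFinv]; split; last exact: smooth_fun_comp.
by move/(smooth_fun_comp sFinv); rewrite comp_cancel.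
Qed.

Lemma pushforward_tangent (R : realType) (m n : nat)
    (M : manifold R m) (N : manifold R n) (F : M -> N) (Finv : N -> M)
    (p : M) (v : (M -> R) -> R) :
  diffeomorphism F Finv -> tangent p v ->
  tangent (F p) (fun k : N -> R => v (k \o F)).
Proof.
move=> dF [v0 vlin vder]; have sE h := diffeo_smooth_fun h dF.
split=> [h nh|a h k /sE sh /sE sk|h k /sE sh /sE sk].
- by apply: v0 => /sE.
- exact: vlin.
- exact: vder.
Qed.

Lemma pushforward_vector_field (R : realType) (m n : nat)
    (M : manifold R m) (N : manifold R n) (F : M -> N) (Finv : N -> M)
    (X : (M -> R) -> (M -> R)) :
  diffeomorphism F Finv -> vector_field X ->
  vector_field (Defs.pushforward F Finv X).
Proof.
move=> dF [Xt Xs]; have [FK FinvK sF sFinv] := dF; split=> [q|h sh].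
  rewrite -[q in tangent q]FinvK.
  exact: pushforward_tangent dF (Xt (Finv q)).
by apply: (smooth_fun_comp sFinv); apply: Xs; exact: smooth_fun_comp.
Qed.

(** The differential of [F] applied at each time; tangent vectors being
    derivations, it is precomposition with [F] of the argument. *)
Definition pushforward_along (R : realType) (m n : nat)
    (M : manifold R m) (N : manifold R n) (F : M -> N)
    (V : R -> (M -> R) -> R) : R -> (N -> R) -> R :=
  fun t k => V t (k \o F).

Lemma pushforward_alongK (R : realType) (m n : nat)
    (M : manifold R m) (N : manifold R n) (F : M -> N) (Finv : N -> M)
    (V : R -> (M -> R) -> R) :
  cancel F Finv -> pushforward_along Finv (pushforward_along F V) = V.
Proof.
move=> FK; apply/funext => t; apply/funext => h.
by rewrite /pushforward_along comp_cancel.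
Qed.

Lemma pushforward_vector_field_along (R : realType) (m n : nat)
    (M : manifold R m) (N : manifold R n) (F : M -> N) (Finv : N -> M)
    (J : set R) (gamma : R -> M) (V : R -> (M -> R) -> R) :
  diffeomorphism F Finv -> vector_field_along J gamma V ->
  vector_field_along J (F \o gamma) (pushforward_along F V).
Proof.
move=> dF [Vt Vs]; split=> [t Jt|h sh].
  exact: pushforward_tangent dF (Vt t Jt).
by apply: Vs; apply/(diffeo_smooth_fun h dF).
Qed.

(** * Transport of covariant derivatives and geodesics *)

Lemma velocity_comp (R : realType) (m n : nat)
    (M : manifold R m) (N : manifold R n) (F : M -> N) (Finv : N -> M)
    (gamma : R -> M) :
  diffeomorphism F Finv ->
  velocity (F \o gamma) = pushforward_along F (velocity gamma).
Proof.
move=> dF; apply/funext => t; apply/funext => k.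
rewrite /pushforward_along /velocity.
by rewrite (asbool_equiv_eq (diffeo_smooth_fun k dF)).
Qed.

(** Conjugation by [F] preserves each clause in the definition of a covariant
    derivative.  In the last one, a field [X] on [N] extending the velocity of
    [F \o gamma] pulls back to one extending the velocity of [gamma], and the
    compatibility of [D] with [nabla] becomes, after pushing forward, the very
    definition of the push-forward connection. *)
Lemma pushforward_covariant_derivative (R : realType) (m n : nat)
    (M : manifold R m) (N : manifold R n) (F : M -> N) (Finv : N -> M)
    (nabla : connection R M) (J : set R) (gamma : R -> M)
    (D : (R -> (M -> R) -> R) -> (R -> (M -> R) -> R)) :
  diffeomorphism F Finv -> covariant_derivative_along nabla J gamma D ->
  covariant_derivative_along (pushforward_connection F Finv nabla) J
    (F \o gamma)
    (fun V => pushforward_along F (D (pushforward_along Finv V))).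
Proof.
move=> dF [Dv Dlin Dleib Dnabla]; have [FK FinvK sF sFinv] := dF.
have dFinv := diffeomorphism_sym dF.
have pull V : vector_field_along J (F \o gamma) V ->
    vector_field_along J gamma (pushforward_along Finv V).
  move=> /(pushforward_vector_field_along dFinv).
  by rewrite (_ : Finv \o (F \o gamma) = gamma)//; apply/funext => t /=.
split.
- by move=> V /pull/Dv; exact: pushforward_vector_field_along dF.
- move=> a V W /pull Vv /pull Wv t Jt; apply/funext => k.
  exact: (congr1 (@^~ (k \o F)) (Dlin a _ _ Vv Wv t Jt)).
- move=> a V sa /pull Vv t Jt; apply/funext => k.
  have /(congr1 (@^~ (k \o F))) := Dleib a _ sa Vv t Jt.
  by rewrite /pushforward_along /= comp_cancel.
- move=> X Y t Xv Yv Jt XE; apply/funext => k.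
  have X'E : at_point (Defs.pushforward Finv F X) (gamma t) = velocity gamma t.
    rewrite -(pushforward_alongK (velocity gamma) FK) -(velocity_comp _ dF).
    by apply/funext => h; rewrite /pushforward_along -XE.
  have := Dnabla _ _ t (pushforward_vector_field dFinv Xv)
    (pushforward_vector_field dFinv Yv) Jt X'E.
  rewrite {1}/pushforward_along => ->.
  by rewrite /at_point /pushforward_connection /Defs.pushforward /= FK.
Qed.

Lemma pushforward_geodesic_on (R : realType) (m n : nat)
    (M : manifold R m) (N : manifold R n) (F : M -> N) (Finv : N -> M)
    (nabla : connection R M) (J : set R) (gamma : R -> M) :
  open J -> diffeomorphism F Finv -> geodesic_on nabla J gamma ->
  geodesic_on (pushforward_connection F Finv nabla) J (F \o gamma).
Proof.
move=> Jo dF [sg [D Dcov Dvel]]; have [FK _ sF _] := dF.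
split; first exact: smooth_curve_comp.
eexists; first exact: pushforward_covariant_derivative dF Dcov.
move=> t Jt; rewrite (velocity_comp _ dF) pushforward_alongK//.
by rewrite /pushforward_along Dvel.
Qed.

Lemma pushforward_geodesic_arc (R : realType) (m n : nat)
    (M : manifold R m) (N : manifold R n) (F : M -> N) (Finv : N -> M)
    (nabla : connection R M) (x y : M) (alpha : R -> M) :
  diffeomorphism F Finv -> geodesic_arc nabla x y alpha ->
  geodesic_arc (pushforward_connection F Finv nabla) (F x) (F y) (F \o alpha).
Proof.
move=> dF [[e e0 ge] <- <-]; split=> //; exists e => //.
apply: pushforward_geodesic_on => //; exact: interval_open.
Qed.

Lemma pushforward_connectionK (R : realType) (m n : nat)
    (M : manifold R m) (N : manifold R n) (F : M -> N) (Finv : N -> M)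
    (nabla : connection R M) : cancel F Finv ->
  pushforward_connection Finv F (pushforward_connection F Finv nabla) = nabla.
Proof.
move=> FK; apply/funext => X; apply/funext => Y.
by rewrite /pushforward_connection !pushforwardK.
Qed.

(** * Geodesic convexity of the push-forward *)

Unset Implicit Arguments.

Theorem theorem4p4 (R : realType) (m n : nat)
    (M : manifold R m) (N : manifold R n)
    (gM : riemannian_metric M) (gN : riemannian_metric N)
    (hM : complete_riemannian gM) (hN : complete_riemannian gN)
    (nabla : connection R M) (hnabla : levi_civita gM nabla)
    (phi : R -> R -> R) (A : set M) (hA : totally_convex nabla A)
    (f : M -> R) (hf : geodesic_phi_convex nabla phi A f)
    (F : M -> N) (Finv : N -> M) (hF : diffeomorphism F Finv) :
  geodesic_phi_convex (pushforward_connection F Finv nabla) phi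
    (F @` A) (f \o Finv).
Proof.
have [FK FinvK _ _] := hF.
have pull x y alpha :
    geodesic_arc (pushforward_connection F Finv nabla) (F x) (F y) alpha ->
    geodesic_arc nabla x y (Finv \o alpha).
  move=> /(pushforward_geodesic_arc (diffeomorphism_sym hF)).
  by rewrite pushforward_connectionK// !FK.
have [_ fconv] := hf; have [[a Aa] Aconv] := hA.
split; first split.
- by exists (F a), a.
- move=> _ _ alpha [x Ax <-] [y Ay <-] /pull arc t t01.
  by exists (Finv (alpha t)); [exact: (Aconv _ _ _ Ax Ay arc)|exact: FinvK].
- move=> _ _ alpha [x Ax <-] [y Ay <-] /pull arc t t01 /=.
  by rewrite !FK; exact: (fconv _ _ _ Ax Ay arc).
Qed.
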